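(* Let $G=\langle a,b\rangle\le \mathrm{Aut}(T)$ be the group generated by the recursively defined automorphisms $a=(1,b)$, $b=(1,a)\varepsilon$ of the rooted binary tree $T$. Let $(Z_n)_{n\ge 0}$ be a symmetric random walk on $G$ with step distribution supported on $\{a,a^{-1},b,b^{-1}\}$. Then there exists $c>0$ (which may depend on the step distribution) such that for all integers $n\ge 0$ $$\mathbf{P}(Z_{2n}=1)\ge e^{-cn^{2/3}}.$$
   Context: $T$ is the rooted binary tree with vertex set $V$ consisting of all finite binary sequences and edge set $\{(v,vi): v\in V,\ i\in\{0,1\}\}$. Automorphisms act on the right, written $g: v\mapsto v^g$, so $v^{gh}=(v^g)^h$. For $g,h\in\mathrm{Aut}(T)$, $(g,h)$ denotes the automorphism sending $0v\mapsto 0v^g$ and $1v\mapsto 1v^h$. The automorphism $\varepsilon$ sends $iv$ to $((i+1)\bmod 2)v$ for $i\in\{0,1\}$. The elements $a,b$ are the unique automorphisms satisfying $a=(1,b)$ and $b=(1,a)\varepsilon$. The random walk is $Z_0=1$, $Z_n=s_1s_2\cdots s_n$ with $s_i$ i.i.d.; the step distribution gives equal positive weight to $a$ and $a^{-1}$ and equal positive weight to $b$ and $b^{-1}$ (i.e. weights proportional to $(1,1,r,r)$ on $(a,a^{-1},b,b^{-1})$ for some $r>0$). *)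

(* Defs.v *)
From HB Require Import structures.
From mathcomp Require Import all_boot all_order all_algebra finmap.
From mathcomp Require Import all_classical all_reals all_analysis.

Set Implicit Arguments.
Unset Strict Implicit.
Unset Printing Implicit Defensive.

Import Order.TTheory GRing.Theory Num.Theory.

Local Open Scope classical_set_scope.

(* The letters 0 and 1 are encoded as false and true; the root is [::].       *)
Definition vertex := seq bool.

Definition edge (u v : vertex) : bool := [exists i : bool, v == rcons u i].

Definition tree_automorphism (f : vertex -> vertex) : Prop :=
  [/\ bijective f, f [::] = [::] & {mono f : u v / edge u v}].

Record treeAut := TreeAut {
  aut_fun :> vertex -> vertex;
  aut_funP : `[< tree_automorphism aut_fun >] }.

HB.instance Definition _ := [isSub for aut_fun].
HB.instance Definition _ := [Choice of treeAut by <:].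

Lemma treeAutP (g : treeAut) : tree_automorphism g.
Proof. by apply/asboolP; case: g. Qed.

Definition mk_aut f (fP : tree_automorphism f) : treeAut := TreeAut (asboolT fP).

Lemma treeAut_eq (g h : treeAut) : g =1 h -> g = h.
Proof. by move=> gh; apply/val_inj/funext. Qed.

Lemma tree_automorphism_id : tree_automorphism id.
Proof. by split=> //; exists id. Qed.

Lemma tree_automorphism_comp f g :
  tree_automorphism f -> tree_automorphism g -> tree_automorphism (g \o f).
Proof.
case=> bf f0 ef [bg g0 eg]; split=> [| |u v] /=; first exact: bij_comp.
  by rewrite f0.
by rewrite eg ef.
Qed.

Lemma tree_automorphism_can f f' : cancel f f' -> cancel f' f ->
  tree_automorphism f -> tree_automorphism f'.
Proof.
move=> fK f'K [_ f0 ef]; split; first by exists f.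
  by rewrite -f0 fK.
by move=> u v; rewrite -{2}(f'K u) -{2}(f'K v) ef.
Qed.

Lemma treeAut_inv_subproof (g : treeAut) :
  { f : vertex -> vertex | cancel g f /\ cancel f g }.
Proof. by apply: cid; case: (treeAutP g) => -[f gK fK] _ _; exists f. Qed.

Lemma treeAut_invP (g : treeAut) :
  tree_automorphism (sval (treeAut_inv_subproof g)).
Proof.
case: treeAut_inv_subproof => f [gK fK] /=.
exact: tree_automorphism_can gK fK (treeAutP g).
Qed.

Definition treeAut_one := mk_aut tree_automorphism_id.
(* Automorphisms act on the right: g * h applies g first, and v^g is g v.     *)
Definition treeAut_mul (g h : treeAut) :=
  mk_aut (tree_automorphism_comp (treeAutP g) (treeAutP h)).
Definition treeAut_inv (g : treeAut) := mk_aut (treeAut_invP g).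

Lemma treeAut_mulA : associative treeAut_mul.
Proof. by move=> f g h; apply: treeAut_eq. Qed.
Lemma treeAut_mul1 : left_id treeAut_one treeAut_mul.
Proof. by move=> g; apply: treeAut_eq. Qed.
Lemma treeAut_mulr1 : right_id treeAut_one treeAut_mul.
Proof. by move=> g; apply: treeAut_eq. Qed.
Lemma treeAut_mulV : left_inverse treeAut_one treeAut_inv treeAut_mul.
Proof.
move=> g; apply: treeAut_eq => v /=.
by case: treeAut_inv_subproof => f [gK fK] /=; rewrite fK.
Qed.
Lemma treeAut_mulrV : right_inverse treeAut_one treeAut_inv treeAut_mul.
Proof.
move=> g; apply: treeAut_eq => v /=.
by case: treeAut_inv_subproof => f [gK fK] /=; rewrite gK.
Qed.

HB.instance Definition _ := isGroup.Build treeAut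
  treeAut_mulA treeAut_mul1 treeAut_mulr1 treeAut_mulV treeAut_mulrV.

Lemma treeAut_mulE (g h : treeAut) v : (g * h)%g v = h (g v).
Proof. by []. Qed.

Lemma edgeE u v : edge u v = (v == rcons u false) || (v == rcons u true).
Proof.
apply/existsP/orP => [[[] ?]|[?|?]];
  by [right | left | exists false | exists true].
Qed.

Lemma edge_cons x y u v : edge (x :: u) (y :: v) = (x == y) && edge u v.
Proof. by rewrite !edgeE /= !eqseq_cons (eq_sym x); case: eqVneq. Qed.

Lemma edge0r u : edge u [::] = false.
Proof. by rewrite edgeE; case: u. Qed.

Lemma edge0l y v : edge [::] (y :: v) = (v == [::]).
Proof. by rewrite edgeE /= !eqseq_cons; case: y; rewrite /= ?orbF. Qed.

Lemma aut_eq0 f v : tree_automorphism f -> (f v == [::]) = (v == [::]).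
Proof. by case=> bf f0 _; rewrite -{1}f0 (inj_eq (bij_inj bf)). Qed.

(* Edges append a letter at the end of a word, whereas (g, h) acts according to
   the first letter.                                                          *)
Definition pair_fun (g h : vertex -> vertex) (v : vertex) : vertex :=
  match v with
  | [::] => [::]
  | false :: w => false :: g w
  | true :: w => true :: h w
  end.

Lemma pair_funP (g h : treeAut) : tree_automorphism (pair_fun g h).
Proof.
have [gP hP] := (treeAutP g, treeAutP h).
have [[g' gK g'K] _ eg] := gP; have [[h' hK h'K] _ eh] := hP.
split=> //; first exists (pair_fun g' h').
- by case=> [|[] w] //=; rewrite ?gK ?hK.
- by case=> [|[] w] //=; rewrite ?g'K ?h'K.
- case=> [|x u] [|y v] //; first by case: y; rewrite /= !edge0l aut_eq0.
    by rewrite !edge0r.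
  by case: x; case: y; rewrite /= !edge_cons /= ?eg ?eh.
Qed.

Definition aut_pair (g h : treeAut) : treeAut := mk_aut (pair_funP g h).

Definition eps_fun (v : vertex) : vertex :=
  if v is i :: w then ~~ i :: w else [::].

Lemma eps_funP : tree_automorphism eps_fun.
Proof.
split=> //; first by exists eps_fun; case=> [|i w] //=; rewrite negbK.
case=> [|x u] [|y v] //=; rewrite ?edge0r ?edge0l // !edge_cons.
by case: x; case: y.
Qed.

Definition aut_eps : treeAut := mk_aut eps_funP.

Fixpoint a_fun (v : vertex) : vertex :=
  match v with
  | [::] => [::]
  | false :: w => false :: w
  | true :: w => true :: b_fun w
  end
with b_fun (v : vertex) : vertex :=
  match v with
  | [::] => [::]
  | false :: w => true :: w
  | true :: w => false :: a_fun w
  end.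

Fixpoint a_inv_fun (v : vertex) : vertex :=
  match v with
  | [::] => [::]
  | false :: w => false :: w
  | true :: w => true :: b_inv_fun w
  end
with b_inv_fun (v : vertex) : vertex :=
  match v with
  | [::] => [::]
  | true :: w => false :: w
  | false :: w => true :: a_inv_fun w
  end.

Lemma ab_funK : cancel a_fun a_inv_fun /\ cancel b_fun b_inv_fun.
Proof.
suff H v : a_inv_fun (a_fun v) = v /\ b_inv_fun (b_fun v) = v.
  by split=> v; case: (H v).
by elim: v => [|[] w [IHa IHb]] //=; rewrite ?IHa ?IHb.
Qed.

Lemma ab_inv_funK : cancel a_inv_fun a_fun /\ cancel b_inv_fun b_fun.
Proof.
suff H v : a_fun (a_inv_fun v) = v /\ b_fun (b_inv_fun v) = v.
  by split=> v; case: (H v).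
by elim: v => [|[] w [IHa IHb]] //=; rewrite ?IHa ?IHb.
Qed.

Lemma ab_fun_edge : {mono a_fun : u v / edge u v} /\ {mono b_fun : u v / edge u v}.
Proof.
suff H u v : edge (a_fun u) (a_fun v) = edge u v /\
             edge (b_fun u) (b_fun v) = edge u v.
  by split=> u v; case: (H u v).
have [a0 b0] : (forall w, (a_fun w == [::]) = (w == [::])) /\
               (forall w, (b_fun w == [::]) = (w == [::])).
  by split=> -[|[] w].
elim: u v => [|x u IH] [|y v]; rewrite ?edge0r //.
  by case: y; rewrite /= !edge0l ?a0 ?b0.
by have [IHa IHb] := IH v; case: x; case: y; rewrite /= !edge_cons /= ?IHa ?IHb.
Qed.

Lemma a_funP : tree_automorphism a_fun.
Proof.
by split=> //; [exists a_inv_fun; [case: ab_funK | case: ab_inv_funK]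
               | case: ab_fun_edge].
Qed.

Lemma b_funP : tree_automorphism b_fun.
Proof.
by split=> //; [exists b_inv_fun; [case: ab_funK | case: ab_inv_funK]
               | case: ab_fun_edge].
Qed.

Definition aut_a : treeAut := mk_aut a_funP.
Definition aut_b : treeAut := mk_aut b_funP.

Lemma aE : aut_a = aut_pair 1%g aut_b.
Proof. by apply: treeAut_eq => -[|[] w]. Qed.

Lemma bE : aut_b = (aut_pair 1 aut_a * aut_eps)%g.
Proof. by apply: treeAut_eq => -[|[] w]. Qed.

Lemma ab_unique (x y : treeAut) :
  x = aut_pair 1%g y -> y = (aut_pair 1 x * aut_eps)%g -> x = aut_a /\ y = aut_b.
Proof.
move=> xE yE; suff H v : x v = aut_a v /\ y v = aut_b v.
  by split; apply: treeAut_eq => v; case: (H v).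
elim: v => [|i w [IHa IHb]]; first by rewrite xE yE.
have xv : x (i :: w) = aut_pair 1%g y (i :: w) by rewrite -xE.
have yv : y (i :: w) = (aut_pair 1 x * aut_eps)%g (i :: w) by rewrite -yE.
by rewrite xv yv; case: {xv yv} i; rewrite /= ?IHa ?IHb.
Qed.

Definition in_G : pred treeAut := fun g =>
  `[< forall H : {pred treeAut},
        group_closed H -> aut_a \in H -> aut_b \in H -> g \in H >].

Lemma in_G_closed : group_closed in_G.
Proof.
split; first by apply/asboolP => H [].
move=> g h /asboolP gG /asboolP hG; apply/asboolP => H Hgrp aH bH.
by case: (Hgrp) => _; apply; [exact: gG | exact: hG].
Qed.

Record G := MkG { G_val :> treeAut; G_valP : in_G G_val }.

HB.instance Definition _ := [isSub for G_val].
HB.instance Definition _ := [Choice of G by <:].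
HB.instance Definition _ := SubChoice_isSubGroup.Build treeAut in_G G in_G_closed.

Lemma in_G_a : in_G aut_a. Proof. by apply/asboolP. Qed.
Lemma in_G_b : in_G aut_b. Proof. by apply/asboolP. Qed.

Definition aG : G := MkG in_G_a.
Definition bG : G := MkG in_G_b.

HB.instance Definition _ := isPointed.Build G 1%g.
HB.instance Definition _ := @isMeasurable.Build default_measure_display
  G discrete_measurable discrete_measurable0
  discrete_measurableC discrete_measurableU.

Local Open Scope ring_scope.
Local Open Scope ereal_scope.

(* The weights are (1, 1, r, r) / (2 + 2r) with r = mu [set bG] / mu [set aG] (the
   four generators are pairwise distinct).                                    *)
Definition symmetric_step (R : realType) (mu : probability G R) : Prop :=
  [/\ 0 < mu [set aG], mu [set aG^-1%g] = mu [set aG],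
      0 < mu [set bG], mu [set bG^-1%g] = mu [set bG]
    & mu [set g | [\/ g = aG, g = aG^-1%g, g = bG | g = bG^-1%g]] = 1].

Definition mutually_independent (I : choiceType) (d d' : measure_display)
    (Omega : measurableType d) (T : measurableType d') (R : realType)
    (P : probability Omega R) (X : I -> {RV P >-> T}) : Prop :=
  forall (J : {fset I}) (A : I -> set T),
    (forall i, i \in J -> measurable (A i)) ->
    P (\bigcap_(i in [set` J]) (X i @^-1` A i)) =
    \prod_(i <- J) P (X i @^-1` A i).

Definition iid (I : choiceType) (d d' : measure_display)
    (Omega : measurableType d) (T : measurableType d') (R : realType)
    (P : probability Omega R) (mu : probability T R)
    (X : I -> {RV P >-> T}) : Prop :=
  mutually_independent X /\ forall i, distribution P (X i) =1 mu.

(* The increments are indexed from 0: s i is the (i+1)-st step.               *)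
Definition walk (Omega : Type) (s : nat -> Omega -> G) (n : nat) (w : Omega) : G :=
  (\prod_(i < n) s i w)%g.

(* Main.v *)
Require Import Defs.
From HB Require Import structures.
From mathcomp Require Import all_boot all_order all_algebra finmap.
From mathcomp Require Import all_classical all_reals all_analysis.
From mathcomp Require Import zify ring lra.
Import Order.TTheory GRing.Theory Num.Theory.
Local Open Scope classical_set_scope.
Local Open Scope ring_scope.

(** The proof estimates how much information is needed to describe [Z_n],
    and then uses that a walk concentrated on few elements returns often: by
    symmetry [P(Z_2n = 1)] is the sum of the squares of the numbers
    [P(Z_n = g)], so by Cauchy-Schwarz it is at least [1/4] divided by the
    number of elements in any set that carries half of the mass of [Z_n].

    Self-similarity provides a small such set. Write [Z_n = (X, Y) eps^k].
    While the walk is read, each of the two coordinates alternates between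
    an active state, where a letter [a^+-1] of the walk multiplies it by
    [b^+-1], and an idle state, where [a^+-1] does nothing to it. Letters
    [b^+-1] switch the state; on the way out of the active state the
    coordinate is multiplied by [a] or by nothing, and on the way back by
    [a^-1] or by nothing, all with probability 1/2. Merging these two half
    steps gives [1] with probability 1/2 and [a^+-1] with probability 1/4
    each. Hence, up to at most one letter at each end, each coordinate
    performs again a symmetric walk of the same kind, with new weights and
    fewer steps. [coord_word] extracts this walk from the word that is read.

    The step count is controlled with a walk killed at a geometric time, for
    which the step counts of the coordinates are again geometric and the law
    of the killed walk is reproduced exactly. If [x] and [y] denote the mean
    numbers of letters [a^+-1] and [b^+-1] read before killing, passing to a
    coordinate acts by the explicit map [next_params]. It satisfies [8 x' y'
    <= x y], and two iterations divide each of [x] and [y] by about 8. After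
    [2 J] levels with [8^J] close to [n], the [4^J] coordinates perform a
    bounded mean number of steps each ([mean_coord_cost]). So with
    probability at least 1/2 the element [Z_n] is described by its
    permutation of the first [2 J] levels and by words of total length
    [O(4^J)], that is, by a string of length [O(4^J) = O(n^(2/3))] over a
    fixed alphabet ([cost_le_decode]). There are [exp(O(n^(2/3)))] such
    strings, and Cauchy-Schwarz ([collision]) gives the bound. *)

(** * Words and sections *)

(** The first component tells [b] from [a], the second marks an inverse. *)
Definition letter : Type := (bool * bool)%type.

Definition gen (x : letter) : treeAut :=
  let g := if x.1 then aut_b else aut_a in if x.2 then (g^-1)%g else g.

Definition ev (w : seq letter) : treeAut :=
  foldr (fun x g => gen x * g)%g 1%g w.

Lemma ev_cat u v : ev (u ++ v) = (ev u * ev v)%g.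
Proof. by elim: u => [|x u IH] /=; rewrite ?mul1g// IH mulgA. Qed.

Definition inv_letter (x : letter) : letter := (x.1, ~~ x.2).
Definition inv_word (w : seq letter) : seq letter := rev (map inv_letter w).

Lemma gen_inv_letter x : gen (inv_letter x) = ((gen x)^-1)%g.
Proof. by case: x => c [] //=; rewrite /gen /= ?invgK. Qed.

Lemma inv_letterK : involutive inv_letter.
Proof. by case=> c e; rewrite /inv_letter /= negbK. Qed.

Lemma inv_wordK : involutive inv_word.
Proof. by move=> w; rewrite /inv_word map_rev revK mapK//;
  apply: inv_letterK.
Qed.

Lemma ev_inv_word w : ev (inv_word w) = ((ev w)^-1)%g.
Proof.
elim: w => [|x w IH]; first by rewrite invg1.
by rewrite /inv_word /= rev_cons -cats1 ev_cat -/(inv_word w) IH /=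
  gen_inv_letter mulg1 invgM.
Qed.

Definition eps (k : bool) : treeAut := if k then aut_eps else 1%g.

Lemma eps_sq : (aut_eps * aut_eps)%g = 1%g.
Proof. by apply: treeAut_eq => -[|[] w]. Qed.

Lemma eps_epsV : (aut_eps^-1)%g = aut_eps.
Proof. by apply: (mulgI aut_eps); rewrite mulgV eps_sq. Qed.

Lemma aut_pair1 : aut_pair 1%g 1%g = 1%g.
Proof. by apply: treeAut_eq => -[|[] w]. Qed.

Lemma aut_pairM g0 g1 h0 h1 :
  (aut_pair g0 g1 * aut_pair h0 h1)%g = aut_pair (g0 * h0)%g (g1 * h1)%g.
Proof. by apply: treeAut_eq => -[|[] w]. Qed.

Lemma aut_pairV g0 g1 : ((aut_pair g0 g1)^-1)%g = aut_pair (g0^-1)%g (g1^-1)%g.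
Proof.
by apply: (mulgI (aut_pair g0 g1)); rewrite aut_pairM !mulgV aut_pair1.
Qed.

Lemma eps_aut_pair g0 g1 :
  (aut_eps * aut_pair g0 g1)%g = (aut_pair g1 g0 * aut_eps)%g.
Proof. by apply: treeAut_eq => -[|[] w]. Qed.

Lemma gen_a e : gen (false, e) = aut_pair 1%g (gen (true, e)).
Proof. by case: e; rewrite {1}/gen /= aE ?aut_pairV ?invg1. Qed.

Lemma gen_b : gen (true, false) = (aut_pair 1%g aut_a * aut_eps)%g.
Proof. by rewrite {1}/gen /= bE. Qed.

Lemma gen_bV : gen (true, true) = (aut_pair (aut_a^-1)%g 1%g * aut_eps)%g.
Proof. by rewrite {1}/gen /= bE invgM aut_pairV invg1 eps_epsV eps_aut_pair.
Qed.

(** The walk of one coordinate. The state [None] is active; [Some p] is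
    idle, and [p] records whether the coordinate was multiplied by [a] when
    it became idle. That factor is withheld until the next [b^+-1] is read,
    so that it can cancel against the factor [a^-1] of the way back: it is
    this merging that makes the output a symmetric walk and that gives the
    exact contraction of the number of steps. *)
Fixpoint coord_word (st : option bool) (w : seq letter) : seq letter :=
  if w is (c, e) :: w' then
    match st, c with
    | None, false => (true, e) :: coord_word None w'
    | None, true => coord_word (Some (~~ e)) w'
    | Some p, false => coord_word (Some p) w'
    | Some p, true =>
        if p == e then coord_word None w' else (false, e) :: coord_word None w'
    end
  else [::].

(** The coordinate which starts in the idle state is inactive up to the
    first [b^+-1]; [after_b w] is the part of [w] that it reads afterwards. *)
Fixpoint after_b (w : seq letter) : seq letter :=
  if w is (c, e) :: w' then if c then w' else after_b w' else [::].

(** The factor withheld in the idle state [Some p]. *)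
Definition pend (p : bool) : treeAut := if p then aut_a else 1%g.

(** The words describe the sections of [g] up to a factor that is still
    withheld when the word ends. *)
Definition sections (g : treeAut) (u0 u1 : seq letter) : Prop :=
  exists f0 f1 k,
    g = (aut_pair (ev u0 * pend f0)%g (ev u1 * pend f1)%g * eps k)%g.

Lemma sections_cat g u0 u1 v0 v1 : sections g u0 u1 ->
  sections (aut_pair (ev v0) (ev v1) * g)%g (v0 ++ u0) (v1 ++ u1).
Proof.
move=> [f0 [f1 [k ->]]]; exists f0, f1, k.
by rewrite mulgA aut_pairM !ev_cat !mulgA.
Qed.

(** At any time one coordinate is active and the other one idle. The two
    conjuncts are the two parities of the number of letters [b^+-1] read so
    far; the factor on the left of [ev w] is what the idle coordinate has
    withheld. *)
Lemma ev_coord_word w p :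
  sections (aut_pair (pend p) 1%g * ev w)%g (coord_word (Some p) w)
    (coord_word None w) /\
  sections (aut_pair 1%g (pend p) * aut_eps * ev w)%g (coord_word None w)
    (coord_word (Some p) w).
Proof.
elim: w p => [|[c e] w IH] p.
  split; rewrite /= mulg1; first by exists p, false, false;
    rewrite /= !mul1g mulg1.
  by exists false, p, true; rewrite /= !mul1g.
have step v0 v1 g g' u0 u1 : sections (g' * ev w)%g u0 u1 ->
    (g * gen (c, e) = aut_pair (ev v0) (ev v1) * g')%g ->
    sections (g * ev ((c, e) :: w))%g (v0 ++ u0) (v1 ++ u1).
  by move=> S E; rewrite /= mulgA E -mulgA; apply: sections_cat.
case: c e step => [] e step; last first.
  split.
    apply: (step [::] [:: (true, e)] _ _ _ _ (proj1 (IH p))).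
    by rewrite gen_a !aut_pairM !mul1g !mulg1 /= mulg1.
  apply: (step [:: (true, e)] [::] _ _ _ _ (proj2 (IH p))).
  by rewrite gen_a -mulgA eps_aut_pair !mulgA !aut_pairM /= !mul1g !mulg1.
pose v : seq letter := if p == e then [::] else [:: (false, e)].
have vE : (ev v = pend p * (if e then aut_a^-1 else 1))%g.
  by rewrite /v; case: (p) (e) => [] []; rewrite /= ?mulgV ?mulg1 ?mul1g.
have bE' : gen (true, e) =
    (aut_pair (if e then aut_a^-1 else 1)%g (pend (~~ e)) * aut_eps)%g.
  by case: (e); rewrite ?gen_b ?gen_bV.
have thE : coord_word (Some p) ((true, e) :: w) = v ++ coord_word None w.
  by rewrite /v /=; case: (p == e).
rewrite thE; split.
  apply: (step v [::] _ _ _ _ (proj2 (IH (~~ e)))).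
  by rewrite bE' vE !mulgA !aut_pairM !mul1g !mulg1.
apply: (step [::] v _ _ _ _ (proj1 (IH (~~ e)))).
rewrite bE' vE -!mulgA (mulgA aut_eps) eps_aut_pair -!mulgA eps_sq mulg1.
by rewrite !aut_pairM !mul1g !mulg1.
Qed.

(** * Descriptions of bounded cost *)

(** An element of cost at most [m] at depth [l] is given by its permutation
    of level [l] of the tree and by words for its [2 ^ l] sections there, of
    total length at most [m]. *)
Fixpoint cost_le l m g : Prop :=
  if l is l'.+1 then
    exists m0 m1 g0 g1 k,
      [/\ (m0 + m1 <= m)%N, cost_le l' m0 g0, cost_le l' m1 g1 &
      g = (aut_pair g0 g1 * eps k)%g]
  else exists2 w, (size w <= m)%N & g = ev w.

Lemma cost_leW l m n g : (m <= n)%N -> cost_le l m g -> cost_le l n g.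
Proof.
case: l => [|l] mn /=; first by case=> w wm ->; exists w => //; lia.
move=> [m0 [m1 [g0 [g1 [k [mm D0 D1 ->]]]]]].
by exists m0, m1, g0, g1, k; split=> //; lia.
Qed.

Lemma eps_addb k k' : (eps k * eps k')%g = eps (k (+) k').
Proof. by case: k k' => [] []; rewrite /= ?mul1g ?mulg1 ?eps_sq. Qed.

Lemma eps_aut_pairk k g0 g1 : (eps k * aut_pair g0 g1)%g =
  (aut_pair (if k then g1 else g0) (if k then g0 else g1) * eps k)%g.
Proof. by case: k; rewrite /= ?mul1g ?mulg1 ?eps_aut_pair. Qed.

Lemma gen_pair x : exists y (c k : bool),
  gen x = (aut_pair (if c then gen y else 1%g) (if c then 1%g else gen y)
           * eps k)%g.
Proof.
case: x => [[] []].
- by exists (false, true), true, true; rewrite gen_bV.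
- by exists (false, false), false, true; rewrite gen_b.
- by exists (true, true), false, false; rewrite gen_a /= mulg1.
- by exists (true, false), false, false; rewrite gen_a /= mulg1.
Qed.

(** A generator has one trivial section, and the other one is a generator.
    So a factor [gen x] costs one letter at every depth, and not one letter
    per coordinate. *)
Lemma cost_le_mul l m g x : cost_le l m g ->
  cost_le l m.+1 (g * gen x)%g /\ cost_le l m.+1 (gen x * g)%g.
Proof.
elim: l m g x => [|l IH] m g x /=.
  move=> [w wm ->]; split.
    by exists (rcons w x); rewrite ?size_rcons// -cats1 ev_cat /= mulg1.
  by exists (x :: w).
move=> [m0 [m1 [g0 [g1 [k [mm D0 D1 ->]]]]]].
have [y [c [k' ->]]] := gen_pair x.
have [D0r D0l] := IH _ _ y D0; have [D1r D1l] := IH _ _ y D1.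
split.
- rewrite mulgA -(mulgA (aut_pair _ _)) eps_aut_pairk mulgA aut_pairM -mulgA
    eps_addb.
  case: k {mm} (mm : (m0 + m1 <= m)%N) => mm; case: c => /=; rewrite mulg1.
  + by exists m0, m1.+1; do 3 eexists; split; [| exact: D0 | exact: D1r |];
      [lia|].
  + by exists m0.+1, m1; do 3 eexists; split; [| exact: D0r | exact: D1 |];
      [lia|].
  + by exists m0.+1, m1; do 3 eexists; split; [| exact: D0r | exact: D1 |];
      [lia|].
  + by exists m0, m1.+1; do 3 eexists; split; [| exact: D0 | exact: D1r |];
      [lia|].
rewrite mulgA -(mulgA (aut_pair _ _)) eps_aut_pairk mulgA aut_pairM -mulgA
  eps_addb.
case: k' {mm} (mm : (m0 + m1 <= m)%N) => mm; case: c => /=; rewrite mul1g.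
- by exists m1.+1, m0; do 3 eexists; split; [| exact: D1l | exact: D0 |];
    [lia|].
- by exists m1, m0.+1; do 3 eexists; split; [| exact: D1 | exact: D0l |];
    [lia|].
- by exists m0.+1, m1; do 3 eexists; split; [| exact: D0l | exact: D1 |];
    [lia|].
- by exists m0, m1.+1; do 3 eexists; split; [| exact: D0 | exact: D1l |];
    [lia|].
Qed.

Lemma cost_le_pend l m g f : cost_le l m g -> cost_le l m.+1 (g * pend f)%g.
Proof.
case: f => Dg; last by rewrite mulg1; apply: cost_leW Dg.
by have [] := cost_le_mul _ _ _ (false, false) Dg.
Qed.

(** The additive constant accounts for one letter in front of the coordinate
    that starts idle, and for one withheld factor at the end of each
    coordinate. *)
Fixpoint coord_cost l w : nat :=
  if l is l'.+1 then (coord_cost l' (coord_word None w) +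
    coord_cost l' (coord_word None (after_b w)) + 3)%N
  else size w.

Lemma coord_word_Some p w : exists2 v, (size v <= 1)%N &
  coord_word (Some p) w = v ++ coord_word None (after_b w).
Proof.
elim: w p => [|[c e] w IH] p /=; first by exists [::].
case: c; last exact: IH.
by case: (p == e); [exists [::] | exists [:: (false, e)]].
Qed.

Lemma cost_le_coord l w : cost_le l (coord_cost l w) (ev w).
Proof.
elim: l w => [|l IH] w /=; first by exists w.
have [f0 [f1 [k]]] := proj1 (ev_coord_word w false).
rewrite aut_pair1 mul1g => ->.
have [v v1 ->] := coord_word_Some false w.
exists (coord_cost l (coord_word None (after_b w))).+2,
  (coord_cost l (coord_word None w)).+1.
do 3 eexists; split; last reflexivity; [lia| |]; last exact/cost_le_pend/IH.
apply/cost_le_pend; rewrite ev_cat.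
case: v v1 => [|x []]//= _; first by rewrite mul1g; apply: cost_leW (IH _).
by rewrite mulg1; apply: (proj2 (cost_le_mul _ _ _ x (IH _))).
Qed.

Lemma coord_word_prefix st w v :
  exists t, coord_word st (w ++ v) = coord_word st w ++ t.
Proof.
elim: w st => [|[c e] w IH] st /=; first by exists (coord_word st v).
have [t0 e0] := IH None.
have [t1 e1] := IH (Some (~~ e)).
case: st => [p|]; last first.
  by case: c; [exists t1 | exists t0; rewrite e0].
case: c; last exact: IH.
by exists t0; rewrite e0; case: ifP.
Qed.

Lemma after_b_prefix w v : exists t, after_b (w ++ v) = after_b w ++ t.
Proof.
elim: w => [|[c e] w IH] /=; first by exists (after_b v).
by case: c; [exists v | exact: IH].
Qed.

(** Reading on can only lengthen the coordinate words. This is what allows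
    the fixed time [n] to be replaced by a random killing time. *)
Lemma coord_cost_prefix l w v : (coord_cost l w <= coord_cost l (w ++ v))%N.
Proof.
elim: l w v => [|l IH] w v /=; first by rewrite size_cat leq_addr.
have [t ->] := coord_word_prefix None w v.
have [u ->] := after_b_prefix w v.
have [t' ->] := coord_word_prefix None (after_b w) u.
by rewrite !leq_add.
Qed.

(** Descriptions are serialized over [option letter]: [None] ends a word,
    and each inner node is one symbol, different from [None] when the
    letters 0 and 1 are exchanged there, followed by its two subtrees. The
    decoders return the unread part of the string, since the code is
    self-delimiting. *)
Fixpoint decode_word (s : seq (option letter)) :
    treeAut * seq (option letter) :=
  match s with
  | Some x :: s' => let r := decode_word s' in (gen x * r.1, r.2)%g
  | None :: s' => (1%g, s')
  | [::] => (1%g, [::])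
  end.

Fixpoint decode l (s : seq (option letter)) : treeAut * seq (option letter) :=
  if l is l'.+1 then
    let r0 := decode l' (behead s) in let r1 := decode l' r0.2 in
    ((aut_pair r0.1 r1.1 * eps (head None s != None))%g, r1.2)
  else decode_word s.

(** Each of the [2 ^ l] words needs one terminator and each of the [2 ^ l -
    1] inner nodes one symbol. *)
Lemma cost_le_decode l m g : cost_le l m g ->
  exists2 s, (size s < m + 2 ^ l.+1)%N & forall r, decode l (s ++ r) = (g, r).
Proof.
elim: l m g => [|l IH] m g /=.
  move=> [w wm ->]; exists (map Some w ++ [:: None]).
    by rewrite size_cat size_map /=; lia.
  by move=> r; elim: w {wm} => [|x w IHw] //=; rewrite IHw.
move=> [m0 [m1 [g0 [g1 [k [mm /IH[s0 z0 E0] /IH[s1 z1 E1] ->]]]]]].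
exists ((if k then Some (false, false) else None) :: s0 ++ s1).
  by rewrite /= size_cat expnS; lia.
by move=> r; rewrite /= -catA E0 /= E1; case: k.
Qed.

Lemma cost_le_code l m N g : cost_le l m g -> (m + 2 ^ l.+1 <= N)%N ->
  exists t : N.-tuple (option letter), (decode l t).1 = g.
Proof.
move=> /cost_le_decode[s sz E] mN.
have zE : size (s ++ nseq (N - size s) None) == N.
  by rewrite size_cat size_nseq; apply/eqP; lia.
by exists (Tuple zE); rewrite /= E.
Qed.

(** * Sums over words *)

Section Green.
Variable R : realType.
Implicit Types (F : seq letter -> R) (al be : R).

Definition prefix_mono F := forall w v, F w <= F (w ++ v).

(** Here [al] and [be] are the total weights of [a^+-1] and of [b^+-1]. *)
Definition step_sum al be (H : letter -> R) : R :=
  al / 2 * (H (false, false) + H (false, true)) +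
  be / 2 * (H (true, false) + H (true, true)).

(** The sum of [weight w * F w] over the words of length at most [N]: the
    Green function of the walk killed with probability [1 - al - be] at each
    step, truncated at time [N] to stay with finite sums. *)
Fixpoint green al be N F : R :=
  F [::] + (if N is N'.+1 then
    step_sum al be (fun x => green al be N' (fun w => F (x :: w))) else 0).

(** For [al + be = 1], the expectation of [F] at a random word of length
    [n]. *)
Fixpoint mean al be n F : R :=
  if n is n'.+1 then
    step_sum al be (fun x => mean al be n' (fun w => F (x :: w)))
  else F [::].

Lemma ler_step_sum al be H K : 0 <= al -> 0 <= be ->
  (forall x, H x <= K x) -> step_sum al be H <= step_sum al be K.
Proof.
move=> a0 b0 HK; rewrite /step_sum lerD// ler_wpM2l ?divr_ge0// lerD//.
Qed.

Lemma step_sumZ c al be H :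
  step_sum al be (fun x => c * H x) = c * step_sum al be H.
Proof. by rewrite /step_sum; ring. Qed.

Lemma step_sum_scale c al be H :
  step_sum (c * al) (c * be) H = c * step_sum al be H.
Proof. by rewrite /step_sum; ring. Qed.

Lemma step_sumD al be H K :
  step_sum al be (fun x => H x + K x) = step_sum al be H + step_sum al be K.
Proof. by rewrite /step_sum; ring. Qed.

Lemma step_sum_cst al be c : step_sum al be (fun=> c) = (al + be) * c.
Proof. by rewrite /step_sum; field. Qed.

Lemma prefix_mono_cons F x : prefix_mono F -> prefix_mono (fun w => F (x :: w)).
Proof. by move=> mF w v; rewrite -cat_cons. Qed.

Section Nonneg.
Context {al be : R} (a0 : 0 <= al) (b0 : 0 <= be).

Lemma green_ge0 N F : (forall w, 0 <= F w) -> 0 <= green al be N F.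
Proof.
elim: N F => [|N IH] F F0 /=; rewrite addr_ge0//.
rewrite -[leLHS](_ : step_sum al be (fun=> 0) = 0);
  last by rewrite step_sum_cst mulr0.
by apply: ler_step_sum => // x; apply: IH.
Qed.

Lemma greenS N F : (forall w, 0 <= F w) ->
  green al be N F <= green al be N.+1 F.
Proof.
elim: N F => [|N IH] F F0.
  by rewrite [leRHS]/= [leLHS]/= lerD//;
    rewrite -[leLHS](_ : step_sum al be (fun=> 0) = 0);
    [apply: ler_step_sum => // x; rewrite /= addr0 | rewrite step_sum_cst
      mulr0].
rewrite [leLHS]/= [leRHS]/=; rewrite lerD2l; apply: ler_step_sum => // x.
exact: IH.
Qed.

Lemma greenD N F F' : green al be N (fun w => F w + F' w) =
  green al be N F + green al be N F'.
Proof.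
elim: N F F' => [|N IH] F F' /=; first by ring.
rewrite [RHS]addrACA -step_sumD; congr (_ + _).
by rewrite /step_sum !IH.
Qed.

Lemma green_cst N c : al + be < 1 -> 0 <= c ->
  (1 - al - be) * green al be N (fun=> c) <= c.
Proof.
move=> q1 c0; have q0 := addr_ge0 a0 b0; have qc := mulr_ge0 q0 c0.
elim: N => [|N IH] /=; first by rewrite addr0; lra.
rewrite step_sum_cst; have := mulr_ge0 q0 (_ : 0 <=
  c - (1 - al - be) * green al be N (fun=> c)).
by rewrite subr_ge0 => /(_ IH); lra.
Qed.

(** A geometric random variable with failure probability [q] has mean [q /
    (1 - q)]. *)
Lemma green_size N : al + be < 1 ->
  (1 - al - be) ^+ 2 * green al be N (fun w => (size w)%:R) <= al + be.
Proof.
move=> q1; elim: N => [|N IH] /=; first by rewrite !addr0 mulr0 addr_ge0.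
rewrite add0r.
have -> : step_sum al be (fun=> green al be N (fun w => ((size w).+1)%:R)) =
    (al + be) * (green al be N (fun=> 1) + green al be N (fun w =>
      (size w)%:R)).
  rewrite step_sum_cst -greenD; congr (_ * _); congr green.
  by apply/funext => w; rewrite -natr1 addrC.
have := green_cst N _ q1 ler01.
move: IH; set g := green _ _ _ _; set h := green _ _ _ _.
move=> g1 h1; have q0 := addr_ge0 a0 b0.
have s0 : 0 <= 1 - al - be by lra.
have H : (1 - al - be) ^+ 2 * (g + h) <= 1.
  have := ler_wpM2l s0 h1; rewrite mulr1 expr2 in g1 *; lra.
by have := ler_wpM2l q0 H; lra.
Qed.

Lemma green_prefix_mono N F : al + be < 1 -> prefix_mono F ->
  (al + be) * green al be N F + F [::] <= green al be N.+1 F.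
Proof.
move=> q1; elim: N F => [|N IH] F mF.
  rewrite /= !addr0 addrC lerD2l -step_sum_cst; apply: ler_step_sum => // x.
  by rewrite addr0; exact: (mF [::] [:: x]).
rewrite [green _ _ N.+1 _]/= [leRHS]/= -/(green _ _ _ _).
rewrite [leRHS](_ : _ = F [::] + step_sum al be (fun x =>
  green al be N.+1 (fun w => F (x :: w))))//.
rewrite addrC lerD2l mulrDr -step_sumZ -step_sum_cst -step_sumD.
apply: ler_step_sum => // x; rewrite addrC.
apply: le_trans (IH _ (prefix_mono_cons _ _ mF)); rewrite lerD2l.
exact: (mF [::] [:: x]).
Qed.

(** By the memoryless property, what follows the first [b^+-1] of a killed
    word is again a killed word, unless no [b^+-1] occurs; in that case [F
    [::]] is the least value of [F]. *)
Lemma green_after_b N F : al + be < 1 -> prefix_mono F ->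
  green al be N (F \o after_b) <= green al be N F.
Proof.
move=> q1 mF; elim: N => [|N IH] //=.
apply: le_trans (green_prefix_mono N F q1 mF); rewrite addrC lerD2r.
have -> : step_sum al be (fun x => green al be N (fun w =>
  (F \o after_b) (x :: w))) =
    al * green al be N (F \o after_b) + be * green al be N F.
  by rewrite /step_sum /comp /=; field.
by have := ler_wpM2l a0 IH; lra.
Qed.

Lemma mean_leS n F : al + be = 1 -> prefix_mono F ->
  mean al be n F <= mean al be n.+1 F.
Proof.
move=> q1; elim: n F => [|n IH] F mF; last first.
  by apply: ler_step_sum => // x; apply: IH; apply: prefix_mono_cons.
rewrite /= -[leLHS]mul1r -q1 -step_sum_cst; apply: ler_step_sum => // x.
exact: (mF [::] [:: x]).
Qed.

Lemma green_mean N q F :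
  green (q * al) (q * be) N F = \sum_(k < N.+1) q ^+ k * mean al be k F.
Proof.
elim: N F => [|N IH] F; first by rewrite big_ord1 /= expr0 mul1r addr0.
rewrite big_ord_recl /= expr0 mul1r; congr (_ + _).
rewrite step_sum_scale /step_sum !IH -!big_split /= !mulr_sumr -big_split /=
  mulr_sumr.
by apply: eq_bigr => i _; rewrite /bump /= exprS /step_sum; ring.
Qed.
End Nonneg.
End Green.
Arguments step_sum {R}.
Arguments green {R}.
Arguments mean {R}.
Arguments prefix_mono {R}.
Arguments greenS {R al be}.
Arguments green_ge0 {R al be}.
Arguments ler_step_sum {R}.

(** * The law of a coordinate *)

(** The constants below are the solution of the first-passage equations of
    [coord_word]. Started idle, the walk returns to the active state before
    it is killed with probability [be / (1 - al)], so [u] is the probability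
    of an excursion to the idle state that is completed. Half of these
    excursions output nothing; conditioning these away divides by [D] and
    leaves the weights [al'] for [a^+-1] and [be'] for [b^+-1]. The factor
    [c] is the mean number of times at which the output equals a given word,
    once it has reached it. *)
Section Transduce.
Variable R : realType.
Implicit Types (F : seq letter -> R).
Variables (al be u D al' be' c : R).
Hypotheses (a0 : 0 <= al) (b0 : 0 <= be) (d0 : 0 < 1 - al).
Hypotheses (a'0 : 0 <= al') (b'0 : 0 <= be') (c1 : 1 <= c).
Hypotheses (du : (1 - al) * u = be ^+ 2) (DE : D = 1 - u / 2)
  (dD : D * al' = u / 2) (dB : D * be' = al)
  (dc : (1 - al) * (D * c) = 1 - al + be).

Let c0 : 0 <= c. Proof. exact: le_trans c1. Qed.

Let avg F N := green al' be' N F +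
  (green al' be' N (fun w => F ((false, false) :: w)) +
   green al' be' N (fun w => F ((false, true) :: w))) / 2.

(** A first-step analysis. The equation of the active state calls the two
    idle ones, so all three are bounded together. Only the sum of the idle
    ones matters, since the withheld factor is [a] or [1] with equal
    weights. *)
Lemma green_coord_word N F : (forall w, 0 <= F w) ->
  green al be N (F \o coord_word None) <= c * green al' be' N F /\
  (1 - al) * (green al be N (F \o coord_word (Some true)) +
              green al be N (F \o coord_word (Some false)))
    <= 2 * F [::] + be * c * avg F N.
Proof.
have avg0 G n : (forall w, 0 <= G w) -> 0 <= avg G n.
  by move=> G0; rewrite /avg addr_ge0 ?divr_ge0 ?addr_ge0// green_ge0.
elim: N F => [|N IH] F F0.
  have f0 := F0 [::]; have af0 := mulr_ge0 a0 f0.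
  split; rewrite /= !addr0; first by rewrite -[leLHS]mul1r ler_wpM2r.
  by have := mulr_ge0 (mulr_ge0 b0 c0) (avg0 F 0%N F0); lra.
have avgS : avg F N <= avg F N.+1.
  by rewrite /avg lerD// ?ler_pM2r ?invr_gt0// ?lerD// greenS.
have [IHo IHe] := IH F F0.
set oo := green al be N (F \o coord_word None) in IHo *.
have [IHaa _] := IH (fun w => F ((false, false) :: w)) (fun w => F0 _).
have [IHaA _] := IH (fun w => F ((false, true) :: w)) (fun w => F0 _).
have [IHba _] := IH (fun w => F ((true, false) :: w)) (fun w => F0 _).
have [IHbA _] := IH (fun w => F ((true, true) :: w)) (fun w => F0 _).
split.
  have gS := greenS a'0 b'0 N F F0.
  have -> : green al be N.+1 (F \o coord_word None) = F [::] +
     al / 2 * (green al be N ((fun w =>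
       F ((true, false) :: w)) \o coord_word None) +
               green al be N ((fun w => F ((true,
                 true) :: w)) \o coord_word None)) +
     be / 2 * (green al be N (F \o coord_word (Some true)) +
              green al be N (F \o coord_word (Some false))) by rewrite /=
                /step_sum addrA.
  have gE : green al' be' N.+1 F = F [::] +
     al' / 2 * (green al' be' N (fun w => F ((false, false) :: w)) +
               green al' be' N (fun w => F ((false, true) :: w))) +
     be' / 2 * (green al' be' N (fun w => F ((true, false) :: w)) +
               green al' be' N (fun w => F ((true, true) :: w)))
    by rewrite /= /step_sum addrA.
  move: gS gE IHe IHba IHbA; rewrite /avg.
  set g' := green al' be' N.+1 F; set g := green al' be' N F.
  set aa := green al' be' N _; set aA := green al' be' N _.
  set ba := green al' be' N _; set bA := green al' be' N _.
  set ot := green al be N (F \o coord_word (Some true)).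
  set of_ := green al be N (F \o coord_word (Some false)).
  set oa := green al be N _; set oA := green al be N _.
  move=> gS gE IHe IHba IHbA.
  rewrite -(ler_pM2l d0).
  have H1 := ler_wpM2l (divr_ge0 b0 (ler0n R 2)) IHe.
  have H2 := ler_wpM2l (mulr_ge0 (ltW d0) (divr_ge0 a0 (ler0n R 2))) (lerD IHba
    IHbA).
  have H3 := ler_wpM2l (mulr_ge0 (mulr_ge0 b0 b0) c0) gS.
  (* the recursion gives D * g'; the remaining u / 2 * g' comes from the
     excursions without output *)
  have H4 : (1 - al) * (c * g') = (1 - al + be) * F [::]
      + be ^+ 2 * c / 2 * (g' + (aa + aA) / 2) +
          (1 - al) * c * (al / 2) * (ba + bA).
    have E : (1 - al) * (c * g') =
        (1 - al) * (c * (D * g')) + (1 - al) * u / 2 * c * g' by rewrite DE;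
          field.
    have E2 : (1 - al) * (c * (D * g')) = (1 - al) * (D * c) * F [::]
      + (1 - al) * c * (D * al') / 2 * (aa + aA)
      + (1 - al) * c * (D * be') / 2 * (ba + bA) by rewrite gE; field.
    rewrite E E2 dc dD dB.
    have E3 : (1 - al) * c * (u / 2) = (1 - al) * u * (c / 2) by ring.
    by rewrite E3 du; ring.
  by rewrite expr2 in H4; lra.
have -> : green al be N.+1 (F \o coord_word (Some true)) +
    green al be N.+1 (F \o coord_word (Some false)) = 2 * F [::] +
   al * (green al be N (F \o coord_word (Some true)) +
         green al be N (F \o coord_word (Some false))) +
   be / 2 * (2 * green al be N (F \o coord_word None) +
      (green al be N ((fun w => F ((false, false) :: w)) \o coord_word None) +
       green al be N ((fun w => F ((false, true) :: w)) \o coord_word None))).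
  by rewrite /= /step_sum /comp /=; field.
move: avgS IHe IHo IHaa IHaA.
set g := green al' be' N F.
set aa := green al' be' N (fun w => F ((false, false) :: w)).
set aA := green al' be' N (fun w => F ((false, true) :: w)).
set ot := green al be N (F \o coord_word (Some true)).
set of_ := green al be N (F \o coord_word (Some false)).
rewrite -/oo.
set oa := green al be N ((fun w => F ((false, false) :: w)) \o coord_word None).
set oA := green al be N ((fun w => F ((false, true) :: w)) \o coord_word None).
set av := avg F N; set av' := avg F N.+1.
move=> avgS IHe IHo IHaa IHaA.
have avE : av = g + (aa + aA) / 2 by [].
have H1 := ler_wpM2l a0 IHe.
have bd := mulr_ge0 b0 (ltW d0).
have H2 : 2 * oo + (oa + oA) <= c * (2 * av) by rewrite avE; lra.
have H3 := ler_wpM2l (divr_ge0 bd (ler0n R 2)) H2.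
have H4 := ler_wpM2l (mulr_ge0 b0 c0) avgS.
lra.
Qed.
End Transduce.

(** [x] and [y] are the mean numbers of letters [a^+-1] and [b^+-1] of a
    killed word, so that [1 / (1 + x + y)] is the killing probability; in
    these coordinates the weights [al'] and [be'] above become rational
    functions with a simple form. *)
Definition next_a (R : realType) (x y : R) := y ^+ 2 / (2 * (2 * y + 1)).
Definition next_b (R : realType) (x y : R) := x * (y + 1) / (2 * y + 1).

(** The expectation of [F] at a killed word, restricted to length at most
    [N]. *)
Definition killed_mean (R : realType) (x y : R) N F : R :=
  green (x / (1 + x + y)) (y / (1 + x + y)) N F / (1 + x + y).

(** The truncation only leaves an inequality: a word of length at most [N]
    produces an output of length at most [N]. *)
Lemma killed_coord_word (R : realType) (x y : R) N F : 0 < x -> 0 < y ->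
  (forall w, 0 <= F w) ->
  killed_mean R x y N (F \o coord_word None) <=
    killed_mean R (next_a R x y) (next_b R x y) N F.
Proof.
move=> x0 y0 F0; rewrite /killed_mean.
set x' := next_a R x y; set y' := next_b R x y.
have x'0 : 0 < x' by rewrite divr_gt0 ?exprn_gt0//; lra.
have y'0 : 0 < y' by rewrite divr_gt0 ?mulr_gt0//; lra.
have s0 : 0 < 1 + x + y by lra.
have s'0 : 0 < 1 + x' + y' by lra.
have ss : 1 + x' + y' <= 1 + x + y.
  suff : x' + y' <= x + y by lra.
  rewrite /x' /y' /next_a /next_b.
  have -> : y ^+ 2 / (2 * (2 * y + 1)) + x * (y + 1) / (2 * y + 1) =
            (y ^+ 2 / 2 + x * (y + 1)) / (2 * y + 1) by field; lra.
  rewrite ler_pdivrMr; last lra.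
  have := mulr_ge0 (ltW x0) (ltW y0); have := sqr_ge0 y; rewrite expr2; lra.
have E : (1 + x' + y') * (2 * (2 * y + 1)) =
    2 * (2 * y + 1) + y ^+ 2 + 2 * x * (y + 1).
  by rewrite /x' /y' /next_a /next_b; field; lra.
(* (y / (1 + x + y)) ^+ 2 / (1 - x / (1 + x + y)) *)
pose u := y ^+ 2 / ((1 + y) * (1 + x + y)).
have s1 : 1 + x + y != 0 by rewrite gt_eqF.
have s2 : 1 + y != 0 by rewrite gt_eqF//; lra.
have s3 : 2 * y + 1 != 0 by rewrite gt_eqF//; lra.
have s4 : 2 * (2 * y + 1) + y ^+ 2 + 2 * x * (y + 1) != 0.
  rewrite gt_eqF//; have := mulr_gt0 x0 y0; have := sqr_ge0 y; lra.
have s5 : 1 + x' + y' != 0 by rewrite gt_eqF.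
have xE : x' * (2 * (2 * y + 1)) = y ^+ 2.
  by rewrite /x' /next_a divfK// mulf_neq0.
have yE : y' * (2 * y + 1) = x * (y + 1) by rewrite /y' /next_b divfK.
have xN : x' / (1 + x' + y') =
    y ^+ 2 / (2 * (2 * y + 1) + y ^+ 2 + 2 * x * (y + 1)).
  by apply/eqP; rewrite eqr_div// -E -xE; apply/eqP; ring.
have yN : y' / (1 + x' + y') =
    2 * x * (y + 1) / (2 * (2 * y + 1) + y ^+ 2 + 2 * x * (y + 1)).
  by apply/eqP; rewrite eqr_div// -E -(mulrA 2 x) -yE; apply/eqP; ring.
have sN : 1 / (1 + x' + y') =
    2 * (2 * y + 1) / (2 * (2 * y + 1) + y ^+ 2 + 2 * x * (y + 1)).
  by apply/eqP; rewrite eqr_div// -E; apply/eqP; ring.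
have [] := green_coord_word R (x / (1 + x + y)) (y / (1 + x + y)) u (1 - u / 2)
  (x' / (1 + x' + y')) (y' / (1 + x' + y')) ((1 + x + y) / (1 + x' + y'))
  _ _ _ _ _ _ _ _ _ _ _ N F F0.
- by rewrite divr_ge0// ltW.
- by rewrite divr_ge0// ltW.
- by rewrite subr_gt0 ltr_pdivrMr//; lra.
- by rewrite divr_ge0// ltW.
- by rewrite divr_ge0// ltW.
- by rewrite ler_pdivlMr// mul1r.
- by rewrite /u; field; rewrite s1 s2.
- by [].
- by rewrite xN /u; field; rewrite s1 s2 s4.
- by rewrite yN /u; field; rewrite s1 s2 s4.
- rewrite (_ : (1 + x + y) / (1 + x' + y') = (1 + x + y) * (1 / (1 + x' + y'))).
    by rewrite sN /u; field; rewrite s1 s2 s4.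
  by rewrite mul1r.
move=> H _; rewrite ler_pdivrMr//; apply: le_trans H _.
by rewrite [leRHS]mulrAC -[leRHS]mulrA mulrC.
Qed.

(** * Contraction of the number of steps *)

Definition next_params (R : realType) (p : R * R) : R * R :=
  (next_a R p.1 p.2, next_b R p.1 p.2).

Section Iterate.
Variable R : realType.
Implicit Types (x y al be : R) (p : R * R).

Lemma next_params_gt0 p : 0 < p.1 -> 0 < p.2 ->
  0 < (next_params R p).1 /\ 0 < (next_params R p).2.
Proof.
case: p => x y /= x0 y0; split.
  by rewrite divr_gt0 ?exprn_gt0//; lra.
by rewrite divr_gt0 ?mulr_gt0//; lra.
Qed.

(** The inequality is [4 y (y + 1) <= (2 y + 1) ^+ 2]. *)
Lemma next_params_prod p : 0 < p.1 -> 0 < p.2 ->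
  8 * ((next_params R p).1 * (next_params R p).2) <= p.1 * p.2.
Proof.
case: p => x y /= x0 y0; rewrite /next_a /next_b.
have d0 : 0 < 2 * y + 1 by lra.
have -> : 8 * (y ^+ 2 / (2 * (2 * y + 1)) * (x * (y + 1) / (2 * y + 1))) =
          x * y * (4 * y * (y + 1)) / (2 * y + 1) ^+ 2.
  by field; rewrite gt_eqF.
rewrite ler_pdivrMr ?exprn_gt0// ler_wpM2l ?mulr_ge0 ?ltW//.
by rewrite expr2; lra.
Qed.

(** The converse bounds, needed to control each factor of the product from
    above: neither factor decays faster than the power of 8, up to an
    additive constant. *)
Lemma next_params2_a p : 0 < p.1 -> 0 < p.2 ->
  p.1 <= 8 * (next_params R (next_params R p)).1 + 1.
Proof.
move=> x0 y0; have [x'0 y'0] := next_params_gt0 p x0 y0; move: x0 y0 x'0 y'0.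
case: p => x y /=; set y' := next_b R x y; rewrite /next_a => x0 y0 _ y'0.
have H1 : x <= 2 * y'.
  rewrite /y' /next_b mulrA ler_pdivlMr; last lra.
  by lra.
have H2 : 2 * y' - 1 <= 8 * (y' ^+ 2 / (2 * (2 * y' + 1))).
  rewrite mulrA ler_pdivlMr; last lra.
  by rewrite expr2; lra.
lra.
Qed.

Lemma next_params2_b p : 0 < p.1 -> 0 < p.2 ->
  p.2 <= 8 * (next_params R (next_params R p)).2 + 1 / 2.
Proof.
move=> x0 y0; have [x'0 y'0] := next_params_gt0 p x0 y0; move: x0 y0 x'0 y'0.
case: p => x y /=; set x' := next_a R x y; set y' := next_b R x y.
rewrite {1}/next_b => x0 y0 x'0 y'0.
have H1 : x' <= 2 * (x' * (y' + 1) / (2 * y' + 1)).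
  rewrite mulrA ler_pdivlMr; last lra.
  by lra.
have H2 : y - 1 / 2 <= 4 * x'.
  rewrite /x' /next_a mulrA ler_pdivlMr; last lra.
  by rewrite expr2; lra.
lra.
Qed.

(** [1 / 7] and [1 / 14] are the fixed points that absorb the additive
    constants [1] and [1 / 2] of the two previous lemmas. *)
Lemma iter_next_params J p : 0 < p.1 -> 0 < p.2 ->
  let p' := iter (2 * J) (next_params R) p in
  [/\ 0 < p'.1, 0 < p'.2, p.1 + 1 / 7 <= 8 ^+ J * (p'.1 + 1 / 7),
     p.2 + 1 / 14 <= 8 ^+ J * (p'.2 + 1 / 14)
   & (8 ^+ J) ^+ 2 * (p'.1 * p'.2) <= p.1 * p.2].
Proof.
elim: J p => [|J IH] p x0 y0.
  by rewrite muln0 /= !expr1n !mul1r; split; lra.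
rewrite (_ : (2 * J.+1 = 2 * J + 2)%N) ?(iterD (2 * J) 2); last lia.
rewrite (_ : iter 2 _ p = next_params R (next_params R p))//.
have [x1 y1] := next_params_gt0 p x0 y0.
have [x2 y2] := next_params_gt0 _ x1 y1.
have e1 := next_params_prod p x0 y0; have e2 := next_params_prod _ x1 y1.
have e3 := next_params2_a p x0 y0; have e4 := next_params2_b p x0 y0.
have [h1 h2 h3 h4 h5] := IH _ x2 y2.
have eS : 8 ^+ J.+1 = 8 * 8 ^+ J :> R by rewrite exprS.
move: h3 h4 h5; rewrite eS exprMn.
set E := 8 ^+ J; set z := iter _ _ _; rewrite -/z => h3 h4 h5.
by split=> //; lra.
Qed.

(** Each of the two numbers is at least [6 / 7] and their product is at most
    [64 C ^+ 2], so both are at most [75 C ^+ 2]. *)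
Lemma iter_next_params_le J (C : R) p : 0 < C ->
  8 ^+ J <= p.1 <= C * 8 ^+ J.+1 -> 8 ^+ J <= p.2 <= C * 8 ^+ J.+1 ->
  (iter (2 * J) (next_params R) p).1 + (iter (2 * J) (next_params R) p).2
    <= 150 * C ^+ 2.
Proof.
move=> C0 /andP[x1 x2] /andP[y1 y2].
have e0 : 0 < 8 ^+ J :> R by rewrite exprn_gt0.
have x0 : 0 < p.1 by apply: lt_le_trans x1.
have y0 : 0 < p.2 by apply: lt_le_trans y1.
have [] := iter_next_params J p x0 y0.
set x := (iter _ _ _).1; set y := (iter _ _ _).2 => x'0 y'0 hx hy hxy.
have lx : 6 / 7 <= x by rewrite -(ler_pM2l e0); lra.
have ly : 6 / 7 <= y by rewrite -(ler_pM2l e0); lra.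
have xy : x * y <= 64 * C ^+ 2.
  have e2 : 0 < (8 ^+ J) ^+ 2 :> R by rewrite exprn_gt0.
  rewrite -(ler_pM2l e2); apply: le_trans hxy _.
  have -> : (8 ^+ J) ^+ 2 * (64 * C ^+ 2) = (C * 8 ^+ J.+1) * (C * 8 ^+ J.+1).
    by rewrite (exprS _ J); ring.
  by apply: ler_pM => //; apply: ltW.
have := mulr_ge0 (ltW x'0) (_ : 0 <= y - 6 / 7); rewrite subr_ge0 => /(_ ly).
have := mulr_ge0 (ltW y'0) (_ : 0 <= x - 6 / 7); rewrite subr_ge0 => /(_ lx).
lra.
Qed.

(** Expected cost is additive over the coordinates, and each of the two
    coordinates of a killed word is dominated by a killed word with the next
    parameters; the cost of a level adds up to [3 (2 ^ l - 1)] in total. *)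
Lemma killed_coord_cost l x y N : 0 < x -> 0 < y ->
  killed_mean R x y N (fun w => (coord_cost l w)%:R) <=
  2 ^+ l * ((iter l (next_params R) (x, y)).1 +
            (iter l (next_params R) (x, y)).2 + 3) - 3.
Proof.
elim: l x y => [|l IH] x y x0 y0; rewrite /killed_mean.
  have s0 : 0 < 1 + x + y by lra.
  have sE : 1 - x / (1 + x + y) - y / (1 + x + y) = (1 + x + y)^-1.
    by field; rewrite gt_eqF.
  have qE : x / (1 + x + y) + y / (1 + x + y) = (x + y) / (1 + x + y).
    by rewrite mulrDl.
  have a0 : 0 <= x / (1 + x + y) by rewrite divr_ge0// ltW.
  have b0 : 0 <= y / (1 + x + y) by rewrite divr_ge0// ltW.
  have := green_size R a0 b0 N; rewrite qE sE ltr_pdivrMr// => /(_ _) /= H.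
  rewrite expr0 mul1r addrK -(ler_pM2r (_ : 0 < (1 + x + y)^-1)) ?invr_gt0//.
  by rewrite -[leLHS]mulrA -expr2 mulrC H//; lra.
have s0 : 0 < 1 + x + y by lra.
have sE : 1 - x / (1 + x + y) - y / (1 + x + y) = (1 + x + y)^-1.
  by field; rewrite gt_eqF.
have q1 : x / (1 + x + y) + y / (1 + x + y) < 1.
  by rewrite -mulrDl ltr_pdivrMr//; lra.
have a0 : 0 <= x / (1 + x + y) by rewrite divr_ge0// ltW.
have b0 : 0 <= y / (1 + x + y) by rewrite divr_ge0// ltW.
pose F w : R := (coord_cost l (coord_word None w))%:R.
have mF : prefix_mono F.
  move=> w v; rewrite /F ler_nat; have [t ->] := coord_word_prefix None w v.
  exact: coord_cost_prefix.
have -> : (fun w => (coord_cost l.+1 w)%:R) = (fun w =>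
  F w + (F \o after_b) w + 3) :> (_ -> R).
  by apply/funext => w; rewrite /= !natrD.
rewrite greenD mulrDl greenD mulrDl.
have h1 := green_after_b R a0 b0 N F q1 mF.
have h2 := green_cst R a0 b0 N 3 q1 (ler0n R 3).
have h3 : killed_mean R x y N F <= killed_mean R (next_params R (x, y)).1
    (next_params R (x, y)).2 N (fun w => (coord_cost l w)%:R).
  by apply: (killed_coord_word R x y N (fun w => (coord_cost l w)%:R)).
have [x'0 y'0] := next_params_gt0 (x, y) x0 y0.
have {h3} := le_trans h3 (IH _ _ x'0 y'0).
rewrite -surjective_pairing iterSr exprS /killed_mean.
set m := iter _ _ _; set gF := green _ _ N F => h3.
change (green _ _ N (fun w => F w)) with gF.
rewrite -(ler_pM2r (_ : 0 < (1 + x + y)^-1)) ?invr_gt0// in h1.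
change (green _ _ N (fun w => (F \o after_b) w)) with
  (green (x / (1 + x + y)) (y / (1 + x + y)) N (F \o after_b)).
rewrite sE mulrC in h2.
rewrite -/gF in h1; set p2 := 2 ^+ l in h3 *; lra.
Qed.

Lemma bernoulli (s : R) k : 0 <= s <= 1 -> 1 - k%:R * s <= (1 - s) ^+ k.
Proof.
move=> /andP[s0 s1]; elim: k => [|k IH]; first by rewrite expr0; lra.
rewrite exprS -natr1.
have h := ler_wpM2l (_ : 0 <= 1 - s) IH; rewrite subr_ge0 in h.
have := h s1; have := mulr_ge0 (ler0n R k) (mulr_ge0 s0 s0); lra.
Qed.

(** With killing probability [1 / (C (n + 1))] the walk survives up to time
    [2 n] with probability at least 1/2, and at each of the [n + 1] times
    between [n] and [2 n] the expectation of [F] is at least the one at time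
    [n]. *)
Lemma mean_le_killed al be (C : R) n F : 0 < al -> 0 < be -> al + be = 1 ->
  4 <= C -> (forall w, 0 <= F w) -> prefix_mono F ->
  mean al be n F <=
    2 * C * killed_mean R (al * (C * n.+1%:R - 1)) (be * (C * n.+1%:R - 1))
      (2 * n) F.
Proof.
move=> a0 b0 q1 C4 F0 mF.
have n1 : 1 <= n.+1%:R :> R by rewrite ler1n.
have Cn : 4 <= C * n.+1%:R by nra.
have Cn0 : 0 < C * n.+1%:R by lra.
set q := 1 - (C * n.+1%:R)^-1.
have E1 : 1 + al * (C * n.+1%:R - 1) + be * (C * n.+1%:R - 1) = C * n.+1%:R.
  by rewrite -addrA -mulrDl q1; lra.
have E2 c : c * (C * n.+1%:R - 1) / (C * n.+1%:R) = q * c.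
  by rewrite /q; move: (C * _) Cn0 => P P0; field; rewrite gt_eqF.
rewrite /killed_mean E1 !E2 green_mean.
have q0 : 0 <= q by rewrite subr_ge0 invf_le1//; lra.
have mean_le k : (n <= k)%N -> mean al be n F <= mean al be k F.
  elim: k => [|k IH]; first by rewrite leqn0 => /eqP ->.
  rewrite leq_eqVlt => /orP[/eqP->//|nk]; apply: le_trans (IH _) _ => //.
  by apply: mean_leS => //; apply: ltW.
have mean_ge0 k : 0 <= mean al be k F.
  by elim: k F F0 {mF mean_le} => [|k IH] F F0 //=;
    rewrite /step_sum addr_ge0// mulr_ge0 ?divr_ge0 ?addr_ge0 ?IH// ltW.
have qk k : (k <= 2 * n)%N -> 1 / 2 <= q ^+ k.
  move=> k2; apply: le_trans (bernoulli _ k _); last first.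
    by apply/andP; split; [rewrite invr_ge0 ltW | rewrite invf_le1//; lra].
  suff : k%:R / (C * n.+1%:R) <= 1 / 2. by move: (_ / _) => z; lra.
  rewrite ler_pdivrMr//.
  have : k%:R <= 2 * n%:R :> R by rewrite -natrM ler_nat.
  have : n%:R + 1 = n.+1%:R :> R by rewrite natr1.
  move=> h1 h2; nra.
suff H : n.+1%:R / 2 * mean al be n F <=
  \sum_(k < (2 * n).+1) q ^+ k * mean al be k F.
  have -> : mean al be n F = 2 * C * (n.+1%:R / 2 * mean al be n F / (C *
    n.+1%:R)).
    have C0 : C != 0 by rewrite gt_eqF//; lra.
    have n0 : n.+1%:R != 0 :> R by rewrite pnatr_eq0.
    by move: n.+1%:R n0 => n' n0; field; rewrite ?C0 ?n0.
  by apply: ler_wpM2l; [lra | rewrite ler_wpM2r ?invr_ge0 ?(ltW Cn0)].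
rewrite -(big_mkord xpredT (fun k => q ^+ k * mean al be k F)).
rewrite (big_cat_nat (n := n))//=; last lia.
apply: ler_wpDl; first by apply: sumr_ge0 => k _; rewrite mulr_ge0 ?exprn_ge0.
have -> : n.+1%:R / 2 * mean al be n F = \sum_(n <=
  k < (2 * n).+1) (1 / 2 * mean al be n F).
  rewrite sumr_const_nat (_ : (2 * n).+1 - n = n.+1)%N; last lia.
  by rewrite -mulr_natl; ring.
apply: ler_sum_nat => k /andP[nk k2]; apply: ler_pM => //; first by apply: qk;
  lia.
exact: mean_le.
Qed.

Lemma mean_coord_cost al be (C : R) n J : 0 < al -> 0 < be -> al + be = 1 ->
  4 <= C -> 1 <= al * C -> 1 <= be * C -> (8 ^ J <= n < 8 ^ J.+1)%N ->
  mean al be n (fun w => (coord_cost (2 * J) w)%:R) <=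
    2 * C * (150 * C ^+ 2 + 3) * 4 ^+ J.
Proof.
move=> a0 b0 q1 C4 aC bC /andP[Jn nJ].
apply: le_trans (mean_le_killed _ _ C _ _ a0 b0 q1 C4 _ _) _ => //.
  by move=> w v; rewrite ler_nat coord_cost_prefix.
rewrite -[leRHS]mulrA; apply: ler_wpM2l; first lra.
have nJ' : n.+1%:R <= 8 ^+ J.+1 :> R by rewrite -natrX ler_nat.
have Jn' : 8 ^+ J <= n%:R :> R by rewrite -natrX ler_nat.
have nS : n%:R + 1 = n.+1%:R :> R by rewrite natr1.
have n0 : 0 <= n%:R :> R by [].
have e0 : 1 <= 8 ^+ J :> R by rewrite exprn_ege1// ler1n.
have bounds c : 0 < c -> c <= 1 -> 1 <= c * C ->
    8 ^+ J <= c * (C * n.+1%:R - 1) <= C * 8 ^+ J.+1.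
  move=> c0 c1 cC; apply/andP; split.
    apply: le_trans Jn' _.
    have : 0 <= (c * C - 1) * n.+1%:R by rewrite mulr_ge0 ?subr_ge0.
    by lra.
  have C0 : 0 <= C by lra.
  have h1 := ler_wpM2l C0 nJ'; apply: le_trans h1.
  have h2 : 0 <= (1 - c) * (C * n.+1%:R - 1).
    by rewrite mulr_ge0 ?subr_ge0// -(mulr1 1) ler_pM//; lra.
  by lra.
have [x1 x2] := (bounds al a0 (ltac:(lra)) aC, bounds be b0 (ltac:(lra)) bC).
have lt0 c : 8 ^+ J <= c <= C * 8 ^+ J.+1 -> 0 < c.
  by case/andP=> h _; lra.
apply: le_trans (killed_coord_cost _ _ _ _ (lt0 _ x1) (lt0 _ x2)) _.
rewrite lerBlDr; apply: ler_wpDr => //.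
rewrite exprM (_ : 2 ^+ 2 = 4); last by ring.
rewrite mulrC ler_wpM2r ?exprn_ge0// lerD2r.
by apply: iter_next_params_le => //; lra.
Qed.
End Iterate.

(** * Collisions *)

Section Collision.
Variable R : realType.
Implicit Types al be : R.

Definition weight (al be : R) (w : seq letter) : R :=
  \prod_(x <- w) (if x.1 then be / 2 else al / 2).

Lemma weight_ge0 al be w : 0 <= al -> 0 <= be -> 0 <= weight al be w.
Proof.
by move=> a0 b0; apply: prodr_ge0 => x _; case: ifP => _; rewrite divr_ge0.
Qed.

Lemma weight_cat al be u v :
  weight al be (u ++ v) = weight al be u * weight al be v.
Proof. by rewrite /weight big_cat. Qed.

Lemma weight_inv_word al be w : weight al be (inv_word w) = weight al be w.
Proof.
rewrite /inv_word -map_rev /weight big_map; apply: perm_big.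
by rewrite perm_rev.
Qed.

Lemma mean_tuple al be n (F : seq letter -> R) :
  mean al be n F = \sum_(w : n.-tuple letter) weight al be w * F w.
Proof.
elim: n F => [|n IH] F /=.
  rewrite (big_pred1 [tuple]) => [|t]; last first.
    by apply/esym/eqP/val_inj/size0nil; rewrite size_tuple.
  by rewrite /weight big_nil mul1r.
rewrite (reindex (fun p : letter * n.-tuple letter =>
  [tuple of p.1 :: p.2])) /=; last first.
  exists (fun t : n.+1.-tuple letter => (thead t, [tuple of behead t])).
    by move=> [x t] _ /=; congr pair; apply: val_inj.
  by move=> t _ /=; rewrite -tuple_eta.
rewrite -(pair_bigA _ (fun x (t : n.-tuple letter) =>
  weight al be (x :: t) * F (x :: t))) /=.
have E x : \sum_(t : n.-tuple letter) weight al be (x :: t) * F (x :: t) =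
    (if x.1 then be / 2 else al / 2) * mean al be n (fun w => F (x :: w)).
  rewrite IH mulr_sumr; apply: eq_bigr => t _.
  by rewrite /weight big_cons mulrA.
rewrite (eq_bigr _ (fun x _ => E x)).
pose H b c := (if b then be / 2 else al / 2) * mean al be n (fun w =>
  F ((b, c) :: w)).
transitivity (\sum_(x : bool * bool) H x.1 x.2); last by apply: eq_bigr => -[].
by rewrite -(pair_bigA _ H) /= !big_bool /H /= /step_sum; ring.
Qed.

Lemma mean_1 al be n : al + be = 1 -> mean al be n (fun=> 1) = 1.
Proof. by move=> q1; elim: n => [|n IH] //=;
  rewrite step_sum_cst q1 IH mul1r. Qed.

Lemma cauchy_schwarz (I T : finType) (k : I -> T) (f : I -> R) :
  (\sum_i f i) ^+ 2 <=
  #|T|%:R * \sum_(p : I * I | k p.1 == k p.2) f p.1 * f p.2.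
Proof.
pose S t := \sum_(i | k i == t) f i.
have E1 : \sum_i f i = \sum_t S t.
  by rewrite (partition_big k xpredT).
have E2 : \sum_(p : I * I | k p.1 == k p.2) f p.1 * f p.2 = \sum_t S t ^+ 2.
  rewrite -(pair_big_dep xpredT (fun i j => k i == k j) (fun i j =>
    f i * f j)) /=.
  rewrite (partition_big k xpredT)//=; apply: eq_bigr => t _.
  rewrite expr2 {1}/S mulr_suml; apply: eq_bigr => i /eqP it.
  rewrite -mulr_sumr; congr (_ * _); apply: eq_bigl => j.
  by rewrite it eq_sym.
rewrite E1 E2.
have : 0 <= \sum_t \sum_t' (S t - S t') ^+ 2.
  by apply: sumr_ge0 => t _; apply: sumr_ge0 => t' _; rewrite sqr_ge0.
have -> : \sum_t \sum_t' (S t - S t') ^+ 2 =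
    2 * (#|T|%:R * (\sum_t S t ^+ 2) - (\sum_t S t) ^+ 2).
  have h t : \sum_t' (S t - S t') ^+ 2 =
      #|T|%:R * S t ^+ 2 + \sum_t' S t' ^+ 2 - 2 * S t * \sum_t' S t'.
    transitivity (\sum_t' (S t ^+ 2 + S t' ^+ 2 - 2 * S t * S t')).
      by apply: eq_bigr => t' _; ring.
    by rewrite !big_split /= sumr_const sumrN -mulr_sumr !mulr_natl.
  rewrite (eq_bigr _ (fun t _ =>
    h t)) !big_split /= sumrN -mulr_suml -!mulr_sumr.
  by rewrite sumr_const -mulr_natl; ring.
by rewrite pmulr_rge0// subr_ge0.
Qed.

(** By Markov's inequality the words of cost at most [m] have total weight
    at least 1/2, and words with the same code have the same value in the
    group. *)
Lemma collision al be n l m : 0 <= al -> 0 <= be -> al + be = 1 -> (0 < m)%N ->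
  2 * mean al be n (fun w => (coord_cost l w)%:R) <= m%:R ->
  (4 * 5 ^+ (m + 2 ^ l.+1))^-1 <=
  \sum_(p : n.-tuple letter * n.-tuple letter | ev p.1 == ev p.2)
    weight al be p.1 * weight al be p.2.
Proof.
move=> a0 b0 q1 m0 hm.
pose N := (m + 2 ^ l.+1)%N.
pose code (w : n.-tuple letter) : N.-tuple (option letter) :=
  odflt [tuple of nseq N None] [pick t : N.-tuple (option letter) | (decode l
    t).1 == ev w].
pose good (w : n.-tuple letter) := (coord_cost l w <= m)%N.
have codeE w : good w -> (decode l (code w)).1 = ev w.
  move=> gw; rewrite /code; case: pickP => [t /eqP//|no].
  have [t tE] := cost_le_code l m N (ev w) (cost_leW _ _ _ _ gw (cost_le_coord
    l w)) (leqnn _).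
  by have := no t; rewrite tE eqxx.
pose f (w : n.-tuple letter) : R := if good w then weight al be w else 0.
have f0 w : 0 <= f w by rewrite /f; case: ifP => // _; exact: weight_ge0.
have half : 1 / 2 <= \sum_w f w.
  have tot : \sum_(w : n.-tuple letter) weight al be w = 1.
    by rewrite -(mean_1 al be n q1) mean_tuple; apply: eq_bigr => w _;
      rewrite mulr1.
  have H : m%:R * (1 - \sum_w f w) <= mean al be n (fun w =>
    (coord_cost l w)%:R).
    have -> : 1 - \sum_w f w = \sum_(w : n.-tuple letter) (weight al be w - f
      w) by rewrite sumrB tot.
    rewrite mulr_sumr mean_tuple; apply: ler_sum => w _.
    rewrite /f /good; case: leqP => mw;
      first by rewrite subrr mulr0 mulr_ge0// weight_ge0.
    by rewrite subr0 mulrC ler_wpM2l ?weight_ge0// ler_nat ltnW.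
  have m0' : 0 < m%:R :> R by rewrite ltr0n.
  by rewrite -(ler_pM2l m0'); lra.
apply: (@le_trans _ _ (\sum_(p : n.-tuple letter * n.-tuple letter | code p.1
  == code p.2) f p.1 * f p.2)).
  have := cauchy_schwarz _ _ code f.
  rewrite card_tuple card_option card_prod card_bool /= natrX => H.
  have p0 : 0 < 5 ^+ N :> R by rewrite exprn_gt0.
  rewrite -(ler_pM2l p0); apply: le_trans H.
  rewrite invfM mulrCA mulfV ?gt_eqF// mulr1.
  have : (1 / 2) ^+ 2 <= (\sum_w f w) ^+ 2.
    by rewrite lerXn2r// nnegrE ?sumr_ge0.
  by rewrite !expr2; lra.
rewrite big_mkcond [leRHS]big_mkcond; apply: ler_sum => -[u v] _ /=.
case: eqP => uv; last by case: ifP => // _; rewrite mulr_ge0 ?weight_ge0.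
rewrite /f; case: (boolP (good u)) => gu; last first.
  by rewrite mul0r; case: ifP => // _; rewrite mulr_ge0 ?weight_ge0.
case: (boolP (good v)) => gv; last first.
  by rewrite mulr0; case: ifP => // _; rewrite mulr_ge0 ?weight_ge0.
by rewrite -(codeE u gu) -(codeE v gv) uv eqxx.
Qed.
End Collision.

(** * The walk on the group *)

Definition genG (x : letter) : G :=
  let g := if x.1 then bG else aG in if x.2 then (g^-1)%g else g.

Lemma G_valV (g : G) : G_val (g^-1)%g = ((G_val g)^-1)%g.
Proof.
apply: (mulgI (G_val g)); rewrite mulgV.
by have /(congr1 G_val) := mulgV g.
Qed.

Lemma G_val_gen x : G_val (genG x) = gen x.
Proof. by case: x => [[] []]; rewrite /genG /gen /= ?G_valV. Qed.

Lemma G_val_prod (r : seq letter) : G_val (\prod_(x <- r) genG x)%g = ev r.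
Proof.
elim: r => [|x r IH]; first by rewrite big_nil.
by rewrite big_cons /= -IH -G_val_gen.
Qed.

Lemma aut_invE (g : treeAut) f : cancel g f -> cancel f g -> (g^-1)%g =1 f.
Proof.
move=> gK fK v; rewrite -{1}(fK v).
by rewrite -[LHS](treeAut_mulE g) mulgV.
Qed.

Lemma genG_inj : injective genG.
Proof.
have aV := aut_invE aut_a _ (proj1 ab_funK) (proj1 ab_inv_funK).
have bV := aut_invE aut_b _ (proj2 ab_funK) (proj2 ab_inv_funK).
pose f (x : letter) := if x.1 then (if x.2 then b_inv_fun else b_fun)
  else (if x.2 then a_inv_fun else a_fun).
have gf x : gen x =1 f x by case: x => [[] []] v.
(* the action on these two vertices separates the four generators *)
pose t (g : treeAut) := (g [:: true; false; true; true], g [:: false; true;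
  true]).
move=> x y /(congr1 (t \o G_val)); rewrite /t /= !G_val_gen !gf.
by case: x y => [[] []] [[] []].
Qed.

Lemma G_countable : countable [set: G].
Proof.
have onto (g : G) : exists w, ev w = g.
  case: g => g /asboolP /(_ (fun g => `[< exists w, ev w = g >])) H /=.
  apply/asboolP; apply: H; last 2 first.
  - by apply/asboolP; exists [:: (false, false)]; rewrite /= mulg1.
  - by apply/asboolP; exists [:: (true, false)]; rewrite /= mulg1.
  split; first by apply/asboolP; exists [::].
  move=> x y /asboolP[u <-] /asboolP[v <-]; apply/asboolP.
  by exists (u ++ inv_word v); rewrite ev_cat ev_inv_word.
have [c cE] := choice onto.
have cI : injective c by move=> g h E; apply: val_inj; rewrite /= -cE E cE.
apply/countable_injP; exists (choice.pickle \o c) =>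
  g h _ _ /= /(pcan_inj choice.pickleK).
exact: cI.
Qed.

Section Prob.
Context (R : realType) (d : measure_display) (Omega : measurableType d)
        (P : probability Omega R).

Lemma sum_disjoint_le (I : eqType) (r : seq I) (F : I -> set Omega) A :
  measurable A -> (forall i, measurable (F i)) -> uniq r ->
  (forall i, i \in r -> F i `<=` A) ->
  (forall i j, i \in r -> j \in r -> i != j -> F i `&` F j = set0) ->
  (\sum_(i <- r) P (F i) <= P A)%E.
Proof.
elim: r A => [|i r IH] A mA mF; first by rewrite big_nil measure_ge0.
move=> /= /andP[ir ur] FA Fd; rewrite big_cons.
have Fi : F i `<=` A by apply: FA; rewrite mem_head.
rewrite -[in leRHS](setDUK Fi) measureU//; first last.
- by rewrite setDE setICA setICr setI0.
- exact: measurableD.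
rewrite leeD2l// IH//; first exact: measurableD.
  move=> j jr x Fjx; split; first by apply: (FA j) => //;
    rewrite in_cons jr orbT.
  move=> Fix; have : (F i `&` F j) x by [].
  rewrite Fd// ?mem_head ?in_cons ?jr ?orbT//.
  by apply: contraNneq ir => ->.
by move=> j k jr kr; apply: Fd; rewrite in_cons ?jr ?kr orbT.
Qed.

Variables (s : nat -> {RV P >-> G}) (mu : probability G R).
Hypothesis (s_iid : iid mu s).

(** Products of measurable functions are measurable here because the
    discrete group [G] is countable. *)
Lemma measurable_walk n (A : set G) : measurable (walk s n @^-1` A).
Proof.
elim: n A => [|n IH] A.
  have w0 : walk s 0 = cst 1%g by apply/funext => o; rewrite /walk big_ord0.
  by rewrite w0 preimage_cst; case: ifP.
rewrite (_ : _ @^-1` _ = \bigcup_(g : G) ((walk s n @^-1` [set g]) `&`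
    (s n @^-1` [set h | A (g * h)%g]))).
  apply: countable_bigcupT_measurable; first exact: G_countable.
  move=> g; apply: measurableI => //.
  by rewrite -[X in measurable X]setTI; apply: (measurable_funP (s n)).
apply/seteqP; split=> w; rewrite /walk /=.
  by rewrite big_ord_recr /= => Aw; eexists.
by case=> g _ [] /=; rewrite big_ord_recr /= => ->.
Qed.

(** The index set is an [fset] to match the definition of independence. *)
Definition cylinder (w : seq letter) : set Omega :=
  \bigcap_(i in [set` seq_fset tt (iota 0 (size w))])
    (s i @^-1` [set genG (nth (false, false) w i)]).

Lemma cylinderE w o i : cylinder w o -> (i < size w)%N ->
  s i o = genG (nth (false, false) w i).
Proof.
move=> cw iw; apply: (cw i).
change (i \in seq_fset tt (iota 0 (size w))).
by rewrite seq_fsetE mem_iota.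
Qed.

Lemma cylinder_walk w o : cylinder w o -> G_val (walk s (size w) o) = ev w.
Proof.
move=> cw; rewrite -G_val_prod (big_nth (false, false)) big_mkord.
by congr G_val; apply: eq_bigr => i _; apply: cylinderE.
Qed.

Lemma cylinder_disjoint u v : size u = size v -> u != v ->
  cylinder u `&` cylinder v = set0.
Proof.
move=> uv ne; apply/seteqP; split=> // o [cu cv]; move: ne => /eqP; apply.
apply: (@eq_from_nth _ (false, false)) => // i iu; apply: genG_inj.
by rewrite -(cylinderE _ _ _ cu iu) -(cylinderE _ _ _ cv)// -uv.
Qed.

Lemma measurable_cylinder w : measurable (cylinder w).
Proof.
apply: fin_bigcap_measurable => // i _.
by rewrite -[X in measurable X]setTI; apply: (measurable_funP (s i)).
Qed.

Lemma prob_cylinder w : P (cylinder w) = (\prod_(x <- w) mu [set genG x])%E.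
Proof.
have [ind dis] := s_iid.
rewrite /cylinder ind => [|i _]; last by [].
rewrite (perm_big _ (seq_fset_perm _ _)) /= undup_id ?iota_uniq//.
rewrite [RHS](big_nth (false, false)) /index_iota subn0.
by apply: eq_bigr => i _; exact: dis.
Qed.

(** The word [u ++ inv_word v] is a loop when [u] and [v] have the same
    value, and by symmetry its weight is the product of the weights of [u]
    and [v]. *)
Lemma return_prob_ge (al be : R) n :
  (forall x, mu [set genG x] = (if x.1 then be / 2 else al / 2)%:E) ->
  ((\sum_(p : n.-tuple letter * n.-tuple letter | ev p.1 == ev p.2)
    weight R al be p.1 * weight R al be p.2)%:E <=
      P [set o | walk s (2 * n) o = 1%g])%E.
Proof.
move=> muE.
pose f (p : n.-tuple letter * n.-tuple letter) : seq letter :=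
  p.1 ++ inv_word p.2.
have sf p : size (f p) = (2 * n)%N.
  by rewrite size_cat size_rev size_map !size_tuple mul2n addnn.
have fI : injective f.
  move=> [u1 u2] [v1 v2] /eqP; rewrite eqseq_cat ?size_tuple// =>
    /andP[/eqP e1 /eqP e2].
  by congr pair; apply: val_inj => //; rewrite /= -(inv_wordK u2) e2 inv_wordK.
have PE p : P (cylinder (f p)) = (weight R al be p.1 * weight R al be p.2)%:E.
  rewrite prob_cylinder (eq_bigr _ (fun x _ => muE x)) prodEFin; congr EFin.
  by rewrite -[LHS]/(weight R al be (f p)) weight_cat weight_inv_word.
rewrite -sumEFin -big_enum /= (eq_bigr _ (fun p _ => esym (PE p))).
apply: (sum_disjoint_le _ _ (cylinder \o f)).
- exact: (measurable_walk _ [set 1%g]).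
- by move=> p; apply: measurable_cylinder.
- exact: enum_uniq.
- move=> p; rewrite mem_enum => pQ o /= /cylinder_walk; rewrite sf => E.
  have /eqP pe : ev p.1 == ev p.2 by exact: pQ.
  by apply: val_inj; rewrite /= E ev_cat ev_inv_word pe mulgV.
- by move=> p q _ _ pq; rewrite cylinder_disjoint ?sf// (inj_eq fI).
Qed.
End Prob.

Lemma symmetric_step_weights (R : realType) (mu : probability G R) :
  symmetric_step mu ->
  exists al be : R, [/\ 0 < al, 0 < be, al + be = 1 &
    forall x, mu [set genG x] = (if x.1 then be / 2 else al / 2)%:E].
Proof.
case=> ma ma' mb mb' tot.
have fa x : mu [set genG x] \is a fin_num by apply: fin_num_measure.
pose al := 2 * fine (mu [set aG]); pose be := 2 * fine (mu [set bG]).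
have muE x : mu [set genG x] = (if x.1 then be / 2 else al / 2)%:E.
  have aE : mu [set aG] = (al / 2)%:E.
    by rewrite /al mulrC mulKf// fineK// (fa (false, false)).
  have bE : mu [set bG] = (be / 2)%:E.
    by rewrite /be mulrC mulKf// fineK// (fa (true, false)).
  by case: x => [[] []] /=; rewrite /genG /= ?ma' ?mb' ?aE ?bE.
exists al, be; split=> //.
- by rewrite /al mulr_gt0// -lte_fin fineK// (fa (false, false)).
- by rewrite /be mulr_gt0// -lte_fin fineK// (fa (true, false)).
pose L : seq letter := [:: (false, false); (false, true); (true, false);
  (true, true)].
have : mu (\bigcup_(x in [set` L]) [set genG x]) = 1%E.
  rewrite -tot; congr (mu _); apply/seteqP; split=> g /=.
    by case=> -[[] []] _ ->; [constructor 4|constructor 3|constructor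
      2|constructor 1].
  by case=> ->; [exists (false, false)|exists (false, true)|exists (true,
    false)|exists (true, true)].
rewrite measure_fin_bigcup//; last first.
  by move=> x y _ _ [g [/= -> /genG_inj]].
rewrite -fsbig_seq// (eq_bigr _ (fun x _ => muE x)) !big_cons big_nil /=.
rewrite adde0 -!EFinD => -[].
lra.
Qed.

Lemma expR_4_ge5 (R : realType) : 5 <= expR 4 :> R.
Proof. by apply: le_trans (expR_ge1Dx _); lra. Qed.

Theorem theorem2 (R : realType) (mu : probability G R)
    (mu_step : symmetric_step mu) :
  exists2 c : R, 0 < c &
    forall (d : measure_display) (Omega : measurableType d)
           (P : probability Omega R) (s : nat -> {RV P >-> G}),
      iid mu s ->
      forall n : nat,
        ((expR (- c * n%:R `^ (2 / 3)))%:E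
           <= P [set w | walk s (2 * n)%N w = 1%g])%E.
Proof.
have [al [be [a0 b0 q1 muE]]] := symmetric_step_weights _ _ mu_step.
have [C [C4 aC bC]] : exists C : nat, [/\ 4 <= C%:R :> R, 1 <= al * C%:R & 1 <=
  be * C%:R].
  pose t := 4 + al^-1 + be^-1.
  have ai : 0 < al^-1 by rewrite invr_gt0.
  have bi : 0 < be^-1 by rewrite invr_gt0.
  have tC : t <= (Num.trunc t).+1%:R by apply/ltW/truncnS_gt.
  exists (Num.trunc t).+1; move: tC; rewrite /t; set N := _%:R => tC.
  split; first lra.
    by rewrite -ler_pdivrMl// mulr1; lra.
  by rewrite -ler_pdivrMl// mulr1; lra.
(* K * 4 ^ J bounds the expected cost of Z_n at depth 2 * J *)
pose K := (2 * C * (150 * C ^ 2 + 3))%N.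
exists (4 * (2 * K + 3)%:R) => [|d Omega P s s_iid n].
  by rewrite mulr_gt0// ltr0n; lia.
have [->|n0] := posnP n.
  rewrite powR0; last by rewrite gt_eqF//; lra.
  rewrite mulr0 expR0 (_ : [set w | _] = setT) ?probability_setT//.
  by apply/seteqP; split=> w //= _; rewrite /walk big_ord0.
pose J := trunc_log 8 n.
have Jn : (8 ^ J <= n < 8 ^ J.+1)%N by rewrite trunc_logP ?trunc_log_ltn.
have HE := mean_coord_cost _ al be C%:R n J a0 b0 q1 C4 aC bC Jn.
pose m := (2 * K * 4 ^ J)%N.
apply: le_trans (return_prob_ge _ _ _ _ s mu s_iid al be n muE).
rewrite lee_fin.
have m0 : (0 < m)%N.
  have C0 : (0 < C)%N by rewrite -(ltr0n R); apply: lt_le_trans C4.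
  by rewrite /m /K !muln_gt0 C0 expn_gt0 /= addn_gt0 orbT.
apply: le_trans (collision _ _ _ n (2 * J) m (ltW a0) (ltW b0) q1 m0 _);
  last first.
  rewrite /m -mulnA natrM ler_pM2l//; apply: le_trans HE _.
  by rewrite /K !natrM natrD !natrM !natrX.
have J23 : (4 ^ J)%:R <= n%:R `^ (2 / 3) :> R.
  rewrite powRrM powR_mulrn//.
  have -> : (4 ^ J)%:R = (((4 ^ J)%:R : R) ^+ 3) `^ 3^-1.
    by rewrite -powR_mulrn// -powRrM mulfV// powRr1.
  apply: ge0_ler_powR; rewrite ?nnegrE ?exprn_ge0//.
  rewrite -!natrX ler_nat -expnM mulnC expnM (_ : 4 ^ 3 =
    8 ^ 2)%N// -expnM mulnC expnM.
  by rewrite leq_exp2r//; case/andP: Jn.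
have e5 := expR_4_ge5 R.
apply: (@le_trans _ _ (expR 4 ^- ((2 * K + 3) * 4 ^ J)%N)).
  rewrite -exprVn -expRN -expRM_natl ler_expR.
  have := ler_wpM2l (ler0n R (2 * K + 3)) J23.
  by rewrite (natrM _ (2 * K + 3)); lra.
have p1 : 0 < expR 4 ^+ ((2 * K +
  3) * 4 ^ J) :> R by rewrite exprn_gt0// expR_gt0.
have p2 : 0 < 4 * 5 ^+ (m + 2 ^ (2 * J).+1) :> R by rewrite mulr_gt0//
  exprn_gt0.
rewrite lef_pV2 ?posrE//.
apply: (@le_trans _ _ (5 ^+ (m + 2 ^ (2 * J).+1).+1)).
  by rewrite exprS ler_wpM2r ?exprn_ge0//; lra.
apply: (@le_trans _ _ (expR 4 ^+ (m + 2 ^ (2 * J).+1).+1)).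
  by rewrite lerXn2r ?nnegrE// expR_ge0.
apply: ler_weXn2l; first lra.
rewrite expnS expnM /m.
have : (0 < 4 ^ J)%N by rewrite expn_gt0.
rewrite (_ : 2 ^ 2 = 4)%N//; lia.
Qed.
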